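(* Suppose that $X$ and $X^*$ are uniformly convex (real) Banach spaces. Let $A:X\rightrightarrows X^*$ be a maximal monotone operator with minimal-norm selection $A^\circ$. If $x\in D(A)$ and $v\in X\setminus\{0\}$ are such that $A(x;v)\neq\emptyset$, then the set $$w\text{-}\operatorname{Limsup}_{\substack{w\to v,\ t\downarrow0\\ x+tw\in D(A)}}A^\circ(x+tw)$$ is a nonempty subset of $A(x;v)$.
   Context: $X^*$ is the continuous dual of the real Banach space $X$, $\langle\cdot,\cdot\rangle$ the duality pairing, $\to$ norm convergence and $\rightharpoonup$ weak convergence. For a set-valued operator $A:X\rightrightarrows X^*$, $D(A)=\{x\in X: Ax\neq\emptyset\}$. $A$ is monotone if $\langle x^*-y^*,x-y\rangle\ge 0$ whenever $x^*\in Ax$, $y^*\in Ay$, and maximal monotone if in addition its graph is not properly contained in the graph of another monotone operator. In this setting, for $x\in D(A)$ the set $Ax$ is nonempty, closed and convex, so it has a unique element of minimal norm, denoted $A^\circ x$; the map $A^\circ:D(A)\to X^*$ is the minimal-norm selection of $A$. For $x\in D(A)$ and $v\in X$, $A(x;v):=\{x^*\in Ax:\langle x^*,v\rangle=\sigma_{Ax}(v)\}$, where $\sigma_{Ax}(v)=\sup\{\langle x^*,v\rangle:x^*\in Ax\}$. $w\text{-}\operatorname{Limsup}_{w\to v,\,t\downarrow0,\,x+tw\in D(A)}A^\circ(x+tw)$ is the set of all $x^*\in X^*$ for which there exist sequences $w_n\to v$ in $X$ and $t_n\downarrow0$ (with $t_n>0$) such that $x+t_nw_n\in D(A)$ for all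 $n\in\mathbb{N}$ and $A^\circ(x+t_nw_n)\rightharpoonup x^*$. *)

(* Defs.v *)
From HB Require Import structures.
From mathcomp Require Import all_boot all_order all_algebra.
From mathcomp Require Import all_classical all_reals.
From mathcomp Require Import ereal topology normedtype sequences.

Set Implicit Arguments.
Unset Strict Implicit.
Unset Printing Implicit Defensive.

Import Order.TTheory GRing.Theory Num.Theory.
Import numFieldNormedType.Exports.

Local Open Scope classical_set_scope.
Local Open Scope ring_scope.

Section dual.
Context {R : realType} (X : normedModType R).

Definition is_dual : {pred X -> R^o} :=
  fun f => `[< linear f /\ continuous f >].

Record dual := Dual { dual_fun :> X -> R^o ; _ : dual_fun \in is_dual }.

HB.instance Definition _ := [isSub for dual_fun].
HB.instance Definition _ := [Choice of dual by <:].

Lemma is_dual_submod_closed : submod_closed is_dual.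
Proof.
split=> [|a f g].
  apply/asboolP; split; last by move=> x; exact: cvg_cst.
  by move=> c x y; rewrite -[0]/(fun=> 0) scaler0 addr0.
move=> /asboolP[lf cf] /asboolP[lg cg]; apply/asboolP; split.
  move=> c x y; rewrite !fctE /= lf lg !scalerDr !scalerA (mulrC c).
  by rewrite addrACA.
move=> x; apply: cvgD; last exact: cg.
by apply: cvgZr; exact: cf.
Qed.

HB.instance Definition _ := GRing.isSubmodClosed.Build R (X -> R^o) is_dual
  is_dual_submod_closed.
HB.instance Definition _ := [SubChoice_isSubLmodule of dual by <:].

Lemma dual_linear (f : dual) : linear f.
Proof. by case: f => f /= /asboolP[]. Qed.

HB.instance Definition _ (f : dual) :=
  GRing.isLinear.Build R X R^o _ (dual_fun f) (dual_linear f).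

Lemma dual_continuous (f : dual) : continuous f.
Proof. by case: f => f /= /asboolP[]. Qed.

Lemma dualDE (f g : dual) x : (f + g) x = f x + g x.
Proof. by []. Qed.

Lemma dualZE a (f : dual) x : (a *: f) x = a * f x.
Proof. by []. Qed.

Definition dual_norm (f : dual) : R :=
  sup [set `|f x| | x in [set x : X | `|x| <= 1]].

Let has_sup_dual (f : dual) :
  has_sup [set `|f x| | x in [set x : X | `|x| <= 1]].
Proof.
split; first by exists `|f 0|, 0 => //=; rewrite normr0.
have /linear_bounded_continuous/bounded_funP/(_ 1)[M fM] :=
  @dual_continuous f.
by exists M => _ [x /= x1 <-]; exact: fM.
Qed.

Let dual_norm_ub (f : dual) x : `|x| <= 1 -> `|f x| <= dual_norm f.
Proof. by move=> x1; apply: ub_le_sup; [case: (has_sup_dual f)|exists x]. Qed.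

Let dual_norm_le (f : dual) M :
  (forall x, `|x| <= 1 -> `|f x| <= M) -> dual_norm f <= M.
Proof.
move=> fM; apply: ge_sup; first by case: (has_sup_dual f).
by move=> _ [x /= x1 <-]; exact: fM.
Qed.

Let dual_normD (f g : dual) : dual_norm (f + g) <= dual_norm f + dual_norm g.
Proof.
apply: dual_norm_le => x x1.
by rewrite dualDE (le_trans (ler_normD _ _))// lerD// dual_norm_ub.
Qed.

Let dual_normZ_le a (f : dual) : dual_norm (a *: f) <= `|a| * dual_norm f.
Proof.
by apply: dual_norm_le => x x1; rewrite dualZE normrM ler_wpM2l// dual_norm_ub.
Qed.

Let dual_normZ a (f : dual) : dual_norm (a *: f) = `|a| * dual_norm f.
Proof.
apply/eqP; rewrite eq_le dual_normZ_le /=.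
have [->|a0] := eqVneq a 0.
  by rewrite normr0 mul0r (le_trans _ (@dual_norm_ub _ 0 _)) ?normr0.
rewrite -ler_pdivlMl ?normr_gt0// -normfV (le_trans _ (dual_normZ_le _ _))//.
by rewrite scalerA mulVf// scale1r.
Qed.

Let dual_norm_bound (f : dual) x : `|f x| <= dual_norm f * `|x|.
Proof.
have [->|x0] := eqVneq x 0; first by rewrite linear0 !normr0 mulr0.
rewrite -ler_pdivrMr ?normr_gt0//.
have -> : `|f x| / `|x| = `|f (`|x|^-1 *: x)|.
  by rewrite linearZ/= normrM normfV normr_id mulrC.
apply: dual_norm_ub.
by rewrite normrZ normfV normr_id mulVf ?normr_eq0.
Qed.

Let dual_norm0 (f : dual) : dual_norm f = 0 -> f = 0.
Proof.
move=> f0; apply/val_inj/funext => x /=; apply/eqP; rewrite -normr_le0.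
by rewrite (le_trans (dual_norm_bound _ _))// f0 mul0r.
Qed.

HB.instance Definition _ :=
  Lmodule_isNormed.Build R dual dual_normD dual_normZ dual_norm0.

Lemma dual_normE (f : dual) :
  `|f| = sup [set `|f x| | x in [set x : X | `|x| <= 1]].
Proof. by []. Qed.

Lemma dual_norm_pairing (f : dual) x : `|f x| <= `|f| * `|x|.
Proof. exact: dual_norm_bound. Qed.

End dual.

Definition uniformly_convex {R : realType} (V : normedModType R) : Prop :=
  forall eps : R, 0 < eps -> exists2 delta : R, 0 < delta &
    forall x y : V, `|x| = 1 -> `|y| = 1 -> eps <= `|x - y| ->
      `|2^-1 *: (x + y)| <= 1 - delta.

(* Weak convergence is tested against the whole dual of [V]; for [V := dual X]
   this is the bidual of [X], so that it is not the weak-* convergence. *)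
Definition weak_cvg {R : realType} {V : normedModType R}
    (u : nat -> V) (l : V) : Prop :=
  forall f : dual V, f (u n) @[n --> \oo] --> f l.

Section operators.
Context {R : realType} {X : normedModType R}.
Implicit Types (A B : X -> set (dual X)) (x v : X).

Definition op_dom A : set X := [set x | A x !=set0].

Definition op_graph A : set (X * dual X) := [set p | A p.1 p.2].

Definition monotone_op A : Prop :=
  forall x y (xs ys : dual X), A x xs -> A y ys -> 0 <= (xs - ys) (x - y).

Definition maximal_monotone_op A : Prop :=
  monotone_op A /\ ~ (exists2 B, monotone_op B & op_graph A `<` op_graph B).

Definition min_norm (S : set (dual X)) : set (dual X) :=
  [set xs | S xs /\ forall ys, S ys -> `|xs| <= `|ys|].

(* The default value 0 is only taken where no element of minimal norm exists,
   in particular outside [op_dom A]. *)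
Definition min_norm_sel A x : dual X := xget 0 (min_norm (A x)).

Definition support_fun (S : set (dual X)) v : \bar R :=
  ereal_sup [set (xs v)%:E | xs in S].

Definition op_face A x v : set (dual X) :=
  [set xs | A x xs /\ (xs v)%:E = support_fun (A x) v].

Definition w_limsup A x v : set (dual X) :=
  [set xs | exists (w : nat -> X) (t : nat -> R),
    [/\ w n @[n --> \oo] --> v,
        t n @[n --> \oo] --> 0,
        forall n, 0 < t n,
        forall n, op_dom A (x + t n *: w n) &
        weak_cvg (fun n => min_norm_sel A (x + t n *: w n)) xs]].

End operators.

(* Main.v *)
(** Let [b] be the element of minimal norm of the face [A(x;v)]. For [c, t > 0]
    the resolvent of [A] of parameter [t c] at [x + t v] gives [w] and
    [a] in [A (x + t w)] with [c a = J (v - w)], [J] being the duality map, and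
    monotonicity against [b] reads
    [c |a|^2 <= <a - b, v> + c |b| |a|]. For fixed [c] and [t] tending to [0],
    the limsup of [<a - b, v>] is at most [0] because weak cluster points of
    [a] belong to [A x]; hence [limsup |a| <= |b|] and [|v - w| = c |a|] is
    small with [c]. Along a diagonal sequence the minimal selections have norms
    at most [|b| + o(1)], while their weak cluster points lie in the face, hence
    have norm at least [|b|]; uniform convexity yields strong convergence to
    [b].

    Weak compactness is replaced by the fact that, in a uniformly convex Banach
    space, a decreasing sequence of closed convex sets meeting a common ball has
    a point in common. The resolvent exists by Rockafellar's theorem, obtained
    by minimizing [F(y, y') + |y|^2 / 2 + |y'|^2 / 2], where [F] is the
    Fitzpatrick function of [A]: uniform convexity makes minimizing sequences
    converge and both duality maps continuous, so that the first-order condition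
    at the minimum produces the required point of the graph. *)

Require Import Defs.
From HB Require Import structures.
From mathcomp Require Import all_boot all_order all_algebra.
From mathcomp Require Import all_classical all_reals.
From mathcomp Require Import ereal topology normedtype sequences.
From mathcomp Require Import ring lra.
Set Implicit Arguments.
Unset Strict Implicit.
Unset Printing Implicit Defensive.
Import Order.TTheory GRing.Theory Num.Theory.
Import numFieldNormedType.Exports.
Local Open Scope classical_set_scope.
Local Open Scope ring_scope.

(** * Quantitative uniform convexity and convergence of sequences *)

(** Uniform convexity freed from normalization, as a lower bound on the parallelogram defect over a
    ball. If the norms differ by at least [e / 4], the defect is at least the square of their
    difference. Otherwise the normalized vectors are at least [3 * e / (4 * M)] apart and the
    hypothesis applies to them. *)
Lemma uniformly_convex_sq (R : realType) (V : normedModType R) :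
  uniformly_convex V -> forall M e : R, 0 < M -> 0 < e ->
  exists2 d : R, 0 < d & forall a b : V, `|a| <= M -> `|b| <= M ->
    e <= `|a - b| -> `|a + b| ^+ 2 + d <= 2 * `|a| ^+ 2 + 2 * `|b| ^+ 2.
Proof.
move=> uc M e M0 e0.
have e1 : 0 < 3 * e / (4 * M) by rewrite divr_gt0// mulr_gt0.
have [d0 d00 Hd] := uc _ e1.
exists (Num.min (e ^+ 2 / 16) (d0 * e ^+ 2 / 2)).
  by rewrite lt_min; apply/andP; split; rewrite divr_gt0// ?mulr_gt0// exprn_gt0.
move=> a b; wlog ab : a b / `|b| <= `|a|.
  move=> H aM bM eab; have [ba|/ltW ba] := leP `|b| `|a|; first exact: H.
  by have := H b a ba bM aM; rewrite distrC => /(_ eab); rewrite (addrC b a); lra.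
move=> aM bM eab.
set al := `|a| in ab aM *; set be := `|b| in ab bM *.
have be0 : 0 <= be by exact: normr_ge0.
have sab : e <= al + be by rewrite (le_trans eab)// ler_normB.
have S1 : `|a + b| <= al + be by exact: ler_normD.
have S0 : 0 <= `|a + b| by exact: normr_ge0.
have [far|near] := leP (e / 4) (al - be).
  rewrite (@le_trans _ _ (`|a + b| ^+ 2 + e ^+ 2 / 16))//.
    by rewrite lerD2l ge_min lexx.
  have : `|a + b| ^+ 2 <= (al + be) ^+ 2.
    by rewrite ler_sqr ?nnegrE// addr_ge0// (le_trans be0).
  have : (e / 4) ^+ 2 <= (al - be) ^+ 2 by rewrite ler_sqr ?nnegrE; lra.
  rewrite !expr2; nra.
have be1 : e / 4 <= be by lra.
have bep : 0 < be by lra.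
have alp : 0 < al by lra.
have unit (z : V) : 0 < `|z| -> exists2 z' : V, z = `|z| *: z' & `|z'| = 1.
  move=> z0; exists (`|z|^-1 *: z).
    by rewrite scalerA divff ?gt_eqF// scale1r.
  by rewrite normrZ normfV normr_id mulVf ?gt_eqF.
have [a' aE na'] := unit _ alp; have [b' bE nb'] := unit _ bep.
rewrite -/al in aE; rewrite -/be in bE.
have dab : 3 * e / (4 * M) <= `|a' - b'|.
  have : `|a - b| <= (al - be) + be * `|a' - b'|.
    have -> : a - b = (al - be) *: a' + be *: (a' - b').
      by rewrite {1}aE {1}bE scalerBl scalerBr addrA subrK.
    rewrite (le_trans (ler_normD _ _))// !normrZ na' mulr1.
    by rewrite ger0_norm ?subr_ge0// ger0_norm.
  rewrite ler_pdivrMr ?mulr_gt0//; have := normr_ge0 (a' - b'); nra.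
have := Hd _ _ na' nb' dab; rewrite normrZ ger0_norm ?invr_ge0// => mid.
have S2 : `|a + b| <= al + be - 2 * be * d0.
  have -> : a + b = (al - be) *: a' + be *: (a' + b').
    by rewrite {1}aE {1}bE scalerBl scalerDr addrA subrK.
  rewrite (le_trans (ler_normD _ _))// !normrZ na' mulr1.
  rewrite ger0_norm ?subr_ge0// ger0_norm//.
  nra.
rewrite (@le_trans _ _ (`|a + b| ^+ 2 + d0 * e ^+ 2 / 2))//.
  by rewrite lerD2l ge_min lexx orbT.
have : `|a + b| * `|a + b| <= (al + be - 2 * be * d0) * (al + be).
  exact: ler_pM.
have : e / 4 * e * (2 * d0) <= be * (al + be) * (2 * d0).
  apply: ler_wpM2r; first by rewrite mulr_ge0// ltW.
  by apply: ler_pM => //; lra.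
have := sqr_ge0 (al - be); rewrite !expr2; nra.
Qed.

Lemma cauchy_seq_cvg (R : realType) (V : completeNormedModType R)
    (u : nat -> V) :
  (forall e : R, 0 < e -> exists N, forall n k, (N <= n)%N -> (N <= k)%N ->
    `|u n - u k| <= e) ->
  exists l : V, u n @[n --> \oo] --> l.
Proof.
move=> H; apply/cvg_ex; apply: cauchy_cvg; apply: cauchy_exP => e e0.
have [N HN] := H (e / 2) (divr_gt0 e0 (ltr0Sn _ 1)).
exists (u N); exists N => // n /= Nn.
rewrite -ball_normE /ball_/= (le_lt_trans (HN _ _ _ Nn))//.
by rewrite ltr_pdivrMr// ltr_pMr// ltr1n.
Qed.

Lemma harmonic_lt (R : realType) (e : R) : 0 < e ->
  exists N, forall n, (N <= n)%N -> n.+1%:R^-1 < e.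
Proof.
move=> e0; have [N _ HN] := cvgr_lt _ (@cvg_harmonic R) _ e0.
by exists N => n /HN.
Qed.

Lemma ler_lim_seq (R : realType) (u w : nat -> R) (l l' : R) :
  u n @[n --> \oo] --> l -> w n @[n --> \oo] --> l' ->
  (forall n, u n <= w n) -> l <= l'.
Proof. by move=> ul wl uw; apply: ler_cvg_to ul wl _; exact: nearW. Qed.

(** * Nested convex sets and minimal-norm points *)

Section minimal_norm.
Context {R : realType} {V : completeNormedModType R}.
Hypothesis uc : uniformly_convex V.

(** Points [c n] of almost minimal norm in [C n] form a Cauchy sequence: the minimal norms [m n]
    increase to [M], and the midpoint of two late points still lies in an earlier set, so its norm
    is almost [M] as well. *)
Lemma nested_convex (C : nat -> set V) (K : R) :
  (forall n k, (n <= k)%N -> C k `<=` C n) ->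
  (forall n a b, C n a -> C n b -> C n (2^-1 *: (a + b))) ->
  (forall n (u : nat -> V) (l : V), (forall k, C n (u k)) ->
    u k @[k --> \oo] --> l -> C n l) ->
  (forall n, exists2 a, C n a & `|a| <= K) ->
  exists2 c, forall n, C n c & `|c| <= K.
Proof.
move=> Cdecr Cmid Cclosed CK.
pose N n := [set `|a| | a in C n].
have Nlb n : has_lbound (N n) by exists 0 => _ [a _ <-].
have N0 n : N n !=set0 by have [a Ca _] := CK n; exists `|a|, a.
pose m n := inf (N n).
have m0 n : 0 <= m n by apply: lb_le_inf => // _ [a _ <-].
have m_le n a : C n a -> m n <= `|a| by move=> Ca; apply: ge_inf => //; exists a.
have mK n : m n <= K by have [a /m_le + aK] := CK n; move/le_trans; apply.
have m_mono n k : (n <= k)%N -> m n <= m k.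
  move=> nk; apply: lb_le_inf => // _ [a Ca <-].
  exact/m_le/(Cdecr _ _ nk).
have : forall n, exists a, C n a /\ `|a| <= m n + n.+1%:R^-1.
  move=> n; have h0 : 0 < n.+1%:R^-1 :> R by rewrite invr_gt0.
  have [_ [a Ca <-] alt] := inf_adherent h0 (conj (N0 n) (Nlb n)).
  by exists a; split => //; exact: ltW.
move/choice => [c cP].
pose M := sup (range m).
have Mub : has_ubound (range m) by exists K => _ [n _ <-].
have mM n : m n <= M by apply: ub_le_sup => //; exists n.
have M0 : 0 <= M := le_trans (m0 0) (mM 0%N).
have [l cl] : exists l : V, c n @[n --> \oo] --> l.
  apply: cauchy_seq_cvg => e e0.
  have M2 : 0 < M + 2 by lra.
  have [d d0 Hd] := uniformly_convex_sq uc M2 e0.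
  (* The defect of [c n] and [c k] is at most [4 * ((M + tau)^2 - (m N2)^2)], hence at most
     [8 * tau * (2 * M + 1)], which has to stay below [d]. *)
  have [tau tau0 [tau1 tauM]] : exists2 tau : R, 0 < tau &
      tau <= 1 /\ 8 * tau * (2 * M + 1) < d.
    exists (Num.min 1 (d / (16 * (2 * M + 1)))).
      by rewrite lt_min ltr01 divr_gt0// mulr_gt0//; lra.
    split; first by rewrite ge_min lexx.
    set q := d / _; have : Num.min 1 q <= q by rewrite ge_min lexx orbT.
    have : q * (16 * (2 * M + 1)) = d by rewrite divfK// mulf_neq0//; lra.
    nra.
  have [N1 HN1] := harmonic_lt tau0.
  have m_nonempty : range m !=set0 by exists (m 0%N), 0%N.
  have [_ [N2 _ <-] HN2] := sup_adherent tau0 (conj m_nonempty Mub).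
  rewrite -/M in HN2.
  exists (maxn N1 N2) => n k; rewrite !geq_max => /andP[n1 n2] /andP[k1 k2].
  have bnd j : (N1 <= j)%N -> `|c j| <= M + tau.
    move=> /HN1/ltW h; rewrite (le_trans (proj2 (cP j)))//; apply: lerD => //.
  rewrite leNgt; apply/negP => /ltW ltd.
  have h1 := bnd _ n1; have h2 := bnd _ k1.
  have : `|c n + c k| ^+ 2 + d <= 2 * `|c n| ^+ 2 + 2 * `|c k| ^+ 2.
    by apply: Hd => //; lra.
  have : m N2 <= `|2^-1 *: (c n + c k)|.
    apply: m_le; apply: Cmid.
      by apply: Cdecr n2 _ _; case: (cP n).
    by apply: Cdecr k2 _ _; case: (cP k).
  rewrite normrZ ger0_norm ?invr_ge0// => h3.
  have : `|c n| ^+ 2 <= (M + tau) ^+ 2 by rewrite ler_sqr ?nnegrE//; lra.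
  have : `|c k| ^+ 2 <= (M + tau) ^+ 2 by rewrite ler_sqr ?nnegrE//; lra.
  have : (2 * m N2) ^+ 2 <= `|c n + c k| ^+ 2.
    by rewrite ler_sqr ?nnegrE ?mulr_ge0//; lra.
  have := m0 N2; have := mM N2.
  move: (`|c n| ^+ 2) (`|c k| ^+ 2) (`|c n + c k| ^+ 2) => p q s.
  rewrite !expr2 => *.
  have : (M + tau - m N2) * (M + tau + m N2) <= 2 * tau * (2 * M + 1).
    by apply: ler_pM; lra.
  nra.
exists l => [n|].
  apply: (Cclosed n (fun k => c (k + n)%N)) => [k|].
    by apply: (Cdecr n (k + n)%N); [rewrite leq_addl|case: (cP (k + n)%N)].
  by rewrite (cvg_shiftn n c).
apply: (@ler_lim_seq _ (fun n => `|c n|) (fun n => K + n.+1%:R^-1)).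
- exact: cvg_norm.
- rewrite -[X in _ --> X]addr0; apply: cvgD; first exact: cvg_cst.
  exact: cvg_harmonic.
- by move=> n; rewrite (le_trans (proj2 (cP n)))// lerD2r.
Qed.

Lemma min_norm_exists (S : set V) : S !=set0 ->
  (forall a b, S a -> S b -> S (2^-1 *: (a + b))) ->
  (forall (u : nat -> V) (l : V), (forall k, S (u k)) ->
    u k @[k --> \oo] --> l -> S l) ->
  exists2 c, S c & forall a, S a -> `|c| <= `|a|.
Proof.
move=> [s Ss] Smid Sclosed.
pose N := [set `|a| | a in S].
have infN : has_inf N.
  by split; [exists `|s|, s|exists 0 => _ [a _ <-]].
(* The slices of [S] by balls whose radii shrink to the infimum of the norms; a common point attains
   it. *)
pose C n := [set a | S a /\ `|a| <= inf N + n.+1%:R^-1].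
have [] := @nested_convex C (inf N + 1).
- move=> n k nk a [Sa aN]; split => //; rewrite (le_trans aN)// lerD2l.
  by rewrite lef_pV2 ?posrE// ler_nat.
- move=> n a b [Sa aN] [Sb bN]; split; first exact: Smid.
  rewrite normrZ ger0_norm ?invr_ge0//.
  by move: (_ + _) aN bN (ler_normD a b) => r aN bN; lra.
- move=> n u l uC ul; split; first by apply: (Sclosed u) => // k; case: (uC k).
  apply: (@ler_lim_seq _ (fun n => `|u n|) (fun=> inf N + n.+1%:R^-1)).
  + exact: cvg_norm.
  + exact: cvg_cst.
  + by move=> k; case: (uC k).
- move=> n; have h0 : 0 < n.+1%:R^-1 :> R by rewrite invr_gt0.
  have [_ [a Sa <-] /ltW aN] := inf_adherent h0 infN.
  exists a => //; rewrite (le_trans aN)// lerD2l.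
  by rewrite invf_le1// ler1n.
move=> c cC _; exists c; first by case: (cC 0%N).
move=> a Sa; rewrite (@le_trans _ _ (inf N))//; last first.
  by apply: ge_inf; [case: infN|exists a].
apply/ler_addgt0Pr => e /harmonic_lt[n /(_ _ (leqnn _))/ltW ne].
by rewrite (le_trans (proj2 (cC n)))// lerD2l.
Qed.

End minimal_norm.

(** * The Hahn-Banach theorem through minimal sublinear functionals *)

Section hahn_banach.
Context {R : realType} {X : lmodType R}.

Definition sublinear (p : X -> R) :=
  (forall x y, p (x + y) <= p x + p y) /\
  (forall a x, 0 <= a -> p (a *: x) = a * p x).

Lemma sublinearI (p : X -> R) : (forall x y, p (x + y) <= p x + p y) ->
  p 0 = 0 -> (forall a x, 0 < a -> p (a *: x) <= a * p x) -> sublinear p.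
Proof.
move=> pD p0 pZ; split => // a x; rewrite le_eqVlt => /predU1P[<-|a0].
  by rewrite scale0r p0 mul0r.
apply/eqP; rewrite eq_le pZ//= -ler_pdivlMl//.
rewrite -{1}[x]scale1r -(mulVf (lt0r_neq0 a0)) -scalerA; apply: pZ.
by rewrite invr_gt0.
Qed.

Lemma sublinear0 (p : X -> R) : sublinear p -> p 0 = 0.
Proof. by move=> [_ /(_ 0 0 (lexx _))]; rewrite scale0r mul0r. Qed.

Lemma sublinearN (p : X -> R) x : sublinear p -> - p (- x) <= p x.
Proof.
move=> sp; have := proj1 sp x (- x); rewrite subrr sublinear0//; lra.
Qed.

(* Tilting: among the functionals below [p], the infimum decreases [p] in the
   direction [- a] as much as sublinearity permits. *)
Definition tilt (p : X -> R) (a x : X) : R :=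
  inf [set p (x + s *: a) - s * p a | s in [set s | 0 <= s]].

Section tilt.
Variables (p : X -> R) (a : X).
Hypothesis sp : sublinear p.

Lemma tilt_le x s : 0 <= s -> tilt p a x <= p (x + s *: a) - s * p a.
Proof.
move=> s0; apply: ge_inf; last by exists s.
exists (- p (- x)) => _ [r /= r0 <-].
have := proj1 sp (x + r *: a) (- x).
by rewrite addrAC subrr add0r (proj2 sp)//; lra.
Qed.

Lemma le_tilt x r : (forall s, 0 <= s -> r <= p (x + s *: a) - s * p a) ->
  r <= tilt p a x.
Proof.
move=> H; apply: lb_le_inf; first by exists (p (x + 0 *: a) - 0 * p a), 0 => /=.
by move=> _ [s /= s0 <-]; exact: H.
Qed.

Lemma sublinear_tilt : sublinear (tilt p a).
Proof.
apply: sublinearI.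
- move=> x y; rewrite -lerBlDl; apply: le_tilt => s s0.
  rewrite lerBlDl -lerBlDr; apply: le_tilt => r r0.
  have := tilt_le (x + y) (addr_ge0 s0 r0).
  have := proj1 sp (x + r *: a) (y + s *: a).
  by rewrite scalerDl addrACA [r *: a + _]addrC; lra.
- apply/eqP; rewrite eq_le; apply/andP; split.
    have := @tilt_le 0 0 (lexx _).
    by rewrite scale0r addr0 mul0r (sublinear0 sp) subr0.
  by apply: le_tilt => s s0; rewrite add0r (proj2 sp)// subrr.
- move=> c x c0; rewrite -ler_pdivrMl//; apply: le_tilt => s s0.
  rewrite ler_pdivrMl//; have := tilt_le (c *: x) (mulr_ge0 (ltW c0) s0).
  by rewrite -scalerA -scalerDr (proj2 sp _ _ (ltW c0)) mulrBr mulrA.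
Qed.

End tilt.

(** Zorn's lemma for the reversed pointwise order. The infimum of a chain is finite because every
    member is at least [- p (- x)] at [x]. *)
Lemma minimal_sublinear (p : X -> R) : sublinear p -> exists2 q : X -> R,
  sublinear q /\ (forall x, q x <= p x) &
  forall q', sublinear q' -> (forall x, q' x <= q x) -> q' = q.
Proof.
move=> sp; pose T := {q : X -> R | sublinear q /\ forall x, q x <= p x}.
pose le (q q' : T) := `[< forall x, sval q' x <= sval q x >].
have [||||t Ht] := @Zorn T le.
- by move=> t; apply/asboolP.
- move=> r s t /asboolP rs /asboolP st; apply/asboolP => x.
  exact: le_trans (st x) (rs x).
- move=> [s Ps] [t Pt] /asboolP/= st /asboolP/= ts.
  have E : s = t by apply/funext => x; apply/eqP; rewrite eq_le st ts.
  by case: _ / E Pt {st ts} => Pt; congr exist; exact: Prop_irrelevance.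
- move=> C Ctot; have [[c0 Cc0]|C0] := pselect (C !=set0); last first.
    exists (exist _ p (conj sp (fun=> lexx _))) => s Cs.
    by exfalso; apply: C0; exists s.
  pose V x := [set sval c x | c in C].
  have Vlb x : has_lbound (V x).
    exists (- p (- x)) => _ [c _ <-]; case: c => c [sc cp] /=.
    by have := sublinearN x sc; have := cp (- x); lra.
  have V0 x : V x !=set0 by exists (sval c0 x), c0.
  pose q x := inf (V x).
  have q_le x (c : T) : C c -> q x <= sval c x.
    by move=> Cc; apply: ge_inf => //; exists c.
  have le_q x r : (forall c : T, C c -> r <= sval c x) -> r <= q x.
    by move=> H; apply: lb_le_inf => // _ [c Cc <-]; exact: H.
  have sq : sublinear q.
    apply: sublinearI.
    + move=> x y; rewrite -lerBlDl; apply: (le_q) => c Cc.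
      rewrite lerBlDl -lerBlDr; apply: (le_q) => d Cd.
      (* Subadditivity of the infimum uses the chain: both terms are compared with the smaller of
         [c] and [d]. *)
      rewrite lerBlDr; have [/asboolP cd|/asboolP dc] := Ctot _ _ Cc Cd.
      * rewrite (le_trans (q_le _ _ Cd))//.
        rewrite (le_trans (proj1 (proj1 (svalP d)) _ _))// lerD2l; exact: cd.
      * rewrite (le_trans (q_le _ _ Cc))//.
        rewrite (le_trans (proj1 (proj1 (svalP c)) _ _))// lerD2r; exact: dc.
    + apply/eqP; rewrite eq_le; apply/andP; split.
        by rewrite (le_trans (q_le _ _ Cc0))// sublinear0//; case: (svalP c0).
      by apply: (le_q) => c _; rewrite sublinear0//; case: (svalP c).
    + move=> a x a0; rewrite -ler_pdivrMl//; apply: (le_q) => c Cc.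
      rewrite ler_pdivrMl// (le_trans (q_le _ _ Cc))//.
      by rewrite (proj2 (proj1 (svalP c)))// ltW.
  have qp x : q x <= p x.
    by rewrite (le_trans (q_le _ _ Cc0))//; case: (svalP c0).
  by exists (exist _ q (conj sq qp)) => s Cs; apply/asboolP => x; exact: q_le.
case: t Ht => q [sq qp] Hq; exists q => // q' sq' q'q.
have q'p x : q' x <= p x by exact: le_trans (q'q x) (qp x).
by have /(congr1 sval) := Hq (exist _ q' (conj sq' q'p)) (asboolT q'q).
Qed.

(** A minimal [q] equals its own tilt in every direction [y]; the tilt estimate at [s = 1] is then
    superadditivity, so [q] itself is linear. *)
Theorem Hahn_Banach_sublinear (p : X -> R) : sublinear p ->
  exists2 f : X -> R^o, linear f & forall x, f x <= p x.
Proof.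
move=> /minimal_sublinear[q [sq qp] qmin]; exists q => //.
have qD x y : q (x + y) = q x + q y.
  apply/eqP; rewrite eq_le (proj1 sq)/=.
  have E : tilt q y = q.
    apply: qmin; first exact: sublinear_tilt.
    move=> z; have := tilt_le y sq z (lexx 0).
    by rewrite scale0r addr0 mul0r subr0.
  have := tilt_le y sq x ler01.
  by rewrite E scale1r mul1r lerBrDr.
have qN x : q (- x) = - q x.
  by apply/eqP; rewrite -addr_eq0 addrC -qD subrr sublinear0.
move=> a x y; rewrite qD; congr (_ + _).
have [a0|a0] := leP 0 a; first by rewrite (proj2 sq).
by rewrite -{1}[a]opprK scaleNr qN (proj2 sq) ?oppr_ge0 ?(ltW a0)// mulNr opprK.
Qed.

End hahn_banach.

(** * The dual space: norming functionals and completeness *)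

Section dual_space.
Context {R : realType} {X : normedModType R}.
Implicit Types (f g : dual X) (x y : X).

Lemma pairDr f x y : f (x + y) = f x + f y :> R.
Proof. exact: linearD. Qed.

Lemma pairBr f x y : f (x - y) = f x - f y :> R.
Proof. exact: linearB. Qed.

Lemma pairNr f x : f (- x) = - f x :> R.
Proof. exact: linearN. Qed.

Lemma pairZr f (a : R) x : f (a *: x) = a * f x :> R.
Proof. exact: linearZ. Qed.

Lemma pairDl f g x : (f + g) x = f x + g x :> R.
Proof. by []. Qed.

Lemma pairBl f g x : (f - g) x = f x - g x :> R.
Proof. by []. Qed.

Lemma pairNl f x : (- f) x = - f x :> R.
Proof. by []. Qed.

Lemma pairZl f (a : R) x : (a *: f) x = a * f x :> R.
Proof. by []. Qed.

Definition pairE :=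
  (pairDl, pairBl, pairNl, pairZl, pairDr, pairBr, pairNr, pairZr).

Lemma pair_le f x : (f x : R) <= `|f| * `|x|.
Proof. exact: le_trans (ler_norm _) (dual_norm_pairing f x). Qed.

Lemma pair_ge f x : - (`|f| * `|x|) <= (f x : R).
Proof. by have := pair_le f (- x); rewrite pairNr normrN lerNl. Qed.

Lemma dual_norm_le (f : dual X) (M : R) : 0 <= M ->
  (forall x, `|f x| <= M * `|x|) -> `|f| <= M.
Proof.
move=> M0 fM; rewrite dual_normE; apply: ge_sup.
  by exists `|f 0|, 0 => //=; rewrite normr0.
by move=> _ [x /= x1 <-]; rewrite (le_trans (fM x))// ler_piMr.
Qed.

Lemma dual_of_bounded (f : X -> R^o) (M : R) : linear f ->
  (forall x, `|f x| <= M * `|x|) -> exists g : dual X, forall x, g x = f x.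
Proof.
move=> lf fM; pose fL := GRing.isLinear.Build R X R^o _ f lf.
pose f' : {linear X -> R^o} := HB.pack f fL.
have cf : continuous f'.
  apply/linear_bounded_continuous/bounded_funP => r.
  exists (`|M| * r) => x xr; rewrite (le_trans (fM x))//.
  by rewrite (le_trans (ler_wpM2r _ (ler_norm M)))// ler_wpM2l.
have fP : f \in @is_dual R X by apply/asboolP.
by exists (Dual fP).
Qed.

(** Tilting [p] at [y] before applying Hahn-Banach forces [f (- y) <= - p y], so the functional
    obtained below the tilt attains its bound at [y]. *)
Lemma norming_functional (y : X) :
  exists2 f : dual X, f y = `|y| ^+ 2 & `|f| = `|y|.
Proof.
pose p (x : X) := `|y| * `|x|.
have sp : sublinear p.
  apply: sublinearI => [x z||a x a0]; rewrite /p.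
  - by rewrite -mulrDr ler_wpM2l// ler_normD.
  - by rewrite normr0 mulr0.
  - by rewrite normrZ gtr0_norm// mulrCA.
have [f lf fp] := Hahn_Banach_sublinear (sublinear_tilt y sp).
have fle x : f x <= p x.
  rewrite (le_trans (fp x))//; have := tilt_le y sp x (lexx 0).
  by rewrite scale0r addr0 mul0r subr0.
have fN x : f (- x) = - f x.
  have f0 : f 0 = 0.
    have := lf 1 0 0; rewrite !scale1r addr0 => /eqP.
    by rewrite -subr_eq subrr => /eqP.
  by have := lf (-1) x 0; rewrite scaleN1r addr0 f0 addr0 scaleN1r.
have fM x : `|f x| <= `|y| * `|x|.
  by rewrite ler_norml fle andbT lerNl -fN (le_trans (fle _))// /p normrN.
have fy : `|y| ^+ 2 <= f y.
  have := le_trans (fp (- y)) (tilt_le y sp (- y) ler01).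
  by rewrite scale1r addNr mul1r fN /p normr0 mulr0 sub0r lerN2 expr2.
have [g gf] := dual_of_bounded lf fM.
exists g.
  by apply/eqP; rewrite eq_le gf fy andbT expr2; exact: fle.
apply/eqP; rewrite eq_le dual_norm_le//=; last by move=> x; rewrite gf.
have [->|y0] := eqVneq y 0; first by rewrite normr0.
rewrite -(@ler_pM2r _ `|y|) ?normr_gt0// -expr2 (le_trans fy)// -gf.
exact: pair_le.
Qed.

(** The limit is taken pointwise; estimates of the form [e * |x|] are closed conditions, so they
    pass to the limit and become norm estimates. Completeness lets the results on uniformly convex
    Banach spaces act on [dual X]. *)
Lemma dual_cauchy_cvg (F : set_system (dual X)) :
  ProperFilter F -> cauchy F -> cvg F.
Proof.
move=> PF /cauchyP Fc.
have near (e : R) : 0 < e -> exists2 g : dual X,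
    F [set f : dual X | `|g - f| < e] &
    forall x, F [set f : dual X | `|g x - f x| <= e * `|x|].
  move=> e0; have [g Fg] := Fc _ e0.
  have Fg' : F [set f : dual X | `|g - f| < e] by move: Fg; rewrite -ball_normE.
  exists g => // x; apply: filterS Fg' => f /ltW gf /=.
  by rewrite -pairBl (le_trans (dual_norm_pairing (g - f) x))// ler_wpM2r.
have cv x : cvg ((f : dual X) x @[f --> F]).
  apply: cauchy_cvg; apply: cauchy_exP => e e0.
  have e1 : 0 < e / (`|x| + 1) by rewrite divr_gt0// ltr_wpDl.
  have [g _ /(_ x) gF] := near _ e1; exists (g x).
  rewrite -ball_normE; apply: (@filterS _ F _ _ _ _ gF) => f /= gf.
  apply: (le_lt_trans gf).
  by rewrite mulrAC ltr_pdivrMr ?ltr_wpDl// ltr_pM2l// ltrDl.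
pose l x : R^o := lim ((f : dual X) x @[f --> F]).
have ll : linear l.
  move=> a x y; apply: cvg_lim => //.
  have -> : (fun f : dual X => f (a *: x + y)) =
            (fun f : dual X => a *: (f x : R^o) + f y).
    by apply/funext => f; rewrite linearP.
  by apply: cvgD; [apply: cvgZl_tmp; exact: cv|exact: cv].
have ldist (e : R) : 0 < e -> forall g : dual X,
    (forall x, F [set f : dual X | `|g x - f x| <= e * `|x|]) ->
    forall x, `|g x - l x| <= e * `|x|.
  move=> e0 g gF x.
  apply: (closed_cvg (fun r : R => `|r| <= e * `|x|) _ (gF x) _).
    by apply: closed_comp (@closed_le R _) => r _; exact: norm_continuous.
  by apply: cvgB; [exact: cvg_cst|exact: cv].
(* An approximation to within 1 shows that the pointwise limit is bounded. *)
have [g1 _ /(ldist _ ltr01) g1l] := near _ ltr01.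
have [] := @dual_of_bounded l (`|g1| + 1) ll.
  move=> x; rewrite -[l x](subKr (g1 x)) (le_trans (ler_normB _ _))//.
  by rewrite mulrDl lerD// dual_norm_pairing.
move=> L Ll; apply/cvg_ex; exists L; apply/cvgrPdist_le => e e0.
have e2 : 0 < e / 2 by rewrite divr_gt0.
have [g gF /(ldist _ e2) gl] := near _ e2.
apply: filterS gF => f /ltW gf.
have gL : `|g - L| <= e / 2.
  by apply: dual_norm_le; [exact: ltW|move=> x; rewrite pairBl Ll].
by rewrite (le_trans (ler_distD g L f))// (distrC L g) (splitr e) lerD.
Qed.

End dual_space.

HB.instance Definition _ (R : realType) (X : normedModType R) :=
  Uniform_isComplete.Build (dual X) (@dual_cauchy_cvg R X).

(** * Limits of pairings and continuity of the duality maps *)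

Section pairing_limits.
Context {R : realType} {X : normedModType R}.
Implicit Types (f : dual X) (x : X).

Lemma cvg_pair (u : nat -> dual X) (w : nat -> X) f x :
  u n @[n --> \oo] --> f -> w n @[n --> \oo] --> x ->
  (u n (w n) : R) @[n --> \oo] --> (f x : R).
Proof.
move=> uf wx.
have -> : (fun n => u n (w n) : R) =
    (fun n => (f (w n) : R) + (u n - f) (w n)).
  by apply/funext => n; rewrite pairBl; ring.
rewrite -[X in _ --> X]addr0; apply: cvgD.
  by apply: cvg_comp wx _; exact: dual_continuous.
apply/norm_cvg0P.
apply: (@squeeze_cvgr _ _ _ _ (fun=> 0) (fun n => `|u n - f| * `|w n|)).
- by apply: nearW => n; rewrite normr_ge0 dual_norm_pairing.
- exact: cvg_cst.
- rewrite -[X in _ --> X](mul0r `|x|) -[X in X * _](@normr0 _ (dual X)).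
  apply: cvgM; apply: cvg_norm => //.
  by rewrite -(subrr f); apply: cvgB => //; exact: cvg_cst.
Qed.

Lemma cvg_pairl (u : nat -> dual X) f x :
  u n @[n --> \oo] --> f -> (u n x : R) @[n --> \oo] --> (f x : R).
Proof. by move=> uf; apply: (@cvg_pair u (fun=> x)) => //; exact: cvg_cst. Qed.

Lemma cvg_pairr f (w : nat -> X) x :
  w n @[n --> \oo] --> x -> (f (w n) : R) @[n --> \oo] --> (f x : R).
Proof. by move=> wx; apply: (@cvg_pair (fun=> f) w) => //; exact: cvg_cst. Qed.

End pairing_limits.

(* Stated for an abstract pairing [B] so that it applies to the duality map of
   [X] and to the one of its dual alike. *)
Lemma duality_map_cvg (R : realType) (V W : normedModType R) (B : V -> W -> R)
    (v : nat -> V) (w : nat -> W) (v0 : V) (w0 : W) :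
  uniformly_convex V ->
  (forall a b z, B (a + b) z = B a z + B b z) ->
  (forall a y z, B a (y - z) = B a y - B a z) ->
  (forall a z, `|B a z| <= `|a| * `|z|) ->
  (forall n, `|v n| = `|w n|) -> (forall n, B (v n) (w n) = `|w n| ^+ 2) ->
  `|v0| = `|w0| -> B v0 w0 = `|w0| ^+ 2 ->
  w n @[n --> \oo] --> w0 -> v n @[n --> \oo] --> v0.
Proof.
move=> uc BD BB Bn vw Bvw v0w0 Bv0 ww0.
pose L := `|w0|.
apply/(@cvgrPdist_le _ V) => e e0.
have L1 : 0 < L + 1 by rewrite ltr_wpDl ?ltr01 ?normr_ge0.
have [d d0 Hd] := uniformly_convex_sq uc L1 e0.
have nw : `|w n| @[n --> \oo] --> L by exact: cvg_norm.
have sw : `|w n| ^+ 2 @[n --> \oo] --> L ^+ 2.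
  by under eq_fun do rewrite expr2; rewrite expr2; exact: cvgM.
have Bw : B (v n) w0 @[n --> \oo] --> L ^+ 2.
  have -> : (fun n => B (v n) w0) = (fun n => `|w n| ^+ 2 - B (v n) (w n - w0)).
    by apply/funext => n; rewrite BB Bvw; ring.
  rewrite -[X in _ --> X]subr0; apply: cvgB => //.
  apply/norm_cvg0P.
  apply: (@squeeze_cvgr _ _ _ _ (fun=> 0) (fun n => `|w n| * `|w n - w0|)).
  - by apply: nearW => n; rewrite normr_ge0 -vw Bn.
  - exact: cvg_cst.
  - rewrite -[X in _ --> X](mulr0 L) -[X in _ * X](@normr0 _ W).
    apply: cvgM => //; apply: cvg_norm => //.
    by rewrite -(subrr w0); apply: cvgB => //; exact: cvg_cst.
near=> n.
have h1 : `|w n| < L + 1 by near: n; apply: cvgr_lt nw _ _; rewrite ltrDl.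
have h2 : `|w n| ^+ 2 < L ^+ 2 + d / 8.
  by near: n; apply: cvgr_lt sw _ _; rewrite ltrDl divr_gt0.
have h3 : L ^+ 2 - d / 8 < B (v n) w0.
  by near: n; apply: cvgr_gt Bw _ _; rewrite ltrBlDr ltrDl divr_gt0.
rewrite leNgt; apply/negP => /ltW far.
(* Pairing with [w0] makes [|v0 + v n|] almost [2 * L], while uniform convexity keeps its square
   away from [4 * L^2] when [v n] is far from [v0]. *)
have := Hd v0 (v n); rewrite vw v0w0 -/L => /(_ _ _ far).
have := le_trans (ler_norm _) (Bn (v0 + v n) w0); rewrite BD Bv0 -/L.
have L0 : 0 <= L by exact: normr_ge0.
move: (`|v0 + v n|) (B (v n) w0) (`|w n|) h1 h2 h3 => S b p h1 h2 h3 h4.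
move=> /(_ _ (ltW h1)) H; have {}H := H ltac:(lra).
have := sqr_ge0 (S - 2 * L); rewrite !expr2 in H h2 h3 h4 *; nra.
Unshelve. all: by end_near.
Qed.

(** The vector is the point [c] of least norm in the half-space [S]. Rescaling any [y] with
    [f y > 0] into [S] and comparing with [c] gives [|c| * f y <= |f|^2 * |y|], hence
    [|c| <= |f|]. *)
Lemma norming_vector (R : realType) (X : completeNormedModType R)
    (f : dual X) : uniformly_convex X ->
  exists2 y : X, (f y : R) = `|f| ^+ 2 & `|y| = `|f|.
Proof.
move=> uc; have [->|f0] := eqVneq f 0.
  by exists 0; rewrite ?normr0 ?expr0n.
have nf : 0 < `|f| by rewrite normr_gt0.
pose S := [set y : X | `|f| ^+ 2 <= f y].
have Spos (y : X) : 0 < (f y : R) -> S ((`|f| ^+ 2 / f y) *: y).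
  by move=> fy; rewrite /S/= pairZr divfK ?gt_eqF.
have [|||c Sc cmin] := @min_norm_exists _ _ uc S.
- apply: contrapT => S0; move/eqP: f0; apply; apply/eqP.
  rewrite -normr_le0; apply: dual_norm_le => // x; rewrite mul0r normr_le0.
  apply/eqP; apply: contrapT => /eqP; rewrite neq_lt => /orP[] fx; apply: S0.
    by eexists; apply: (Spos (- x)); rewrite pairNr oppr_gt0.
  by eexists; exact: Spos fx.
- by move=> a b; rewrite /S/= pairZr pairDr; lra.
- move=> u l uS ul; apply: (ler_lim_seq _ (cvg_pairr (f := f) ul) uS).
  exact: cvg_cst.
have cle (y : X) : `|c| * (f y : R) <= `|f| ^+ 2 * `|y|.
  have [fy|fy] := leP (f y : R) 0.
    by rewrite (@le_trans _ _ 0)// ?mulr_ge0// mulr_ge0_le0.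
  have := cmin _ (Spos _ fy).
  rewrite normrZ ger0_norm ?divr_ge0 ?(ltW fy)//.
  by rewrite mulrAC ler_pdivlMr.
have cf : `|c| <= `|f|.
  have : `| `|c| *: f| <= `|f| ^+ 2.
    apply: dual_norm_le => // y; rewrite pairZl ler_norml cle andbT.
    by rewrite lerNl -mulrN -pairNr -(normrN y) cle.
  by rewrite normrZ normr_id expr2 ler_pM2r.
have fc := pair_le f c.
have E : `|c| = `|f|.
  apply/eqP; rewrite eq_le cf/= -(@ler_pM2l _ `|f|)// -expr2.
  exact: le_trans Sc fc.
exists c => //; apply/eqP; rewrite eq_le; apply/andP; split => //.
by rewrite expr2 -{2}E.
Qed.

(** * Maximality and Rockafellar's theorem *)

(** Adjoining [(x, xs)] to the graph keeps it monotone, so by maximality it was already there. *)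
Lemma maximal_monotone_mem (R : realType) (X : normedModType R)
    (A : X -> set (dual X)) x xs : maximal_monotone_op A ->
  (forall y ys, A y ys -> 0 <= ((xs - ys) (x - y) : R)) -> A x xs.
Proof.
move=> [mA maxA] H; apply: contrapT => nA; apply: maxA.
pose B y : set (dual X) := [set ys | A y ys \/ (y = x /\ ys = xs)].
exists B.
  move=> y z ys zs [Ay|[-> ->]] [Az|[-> ->]].
  - exact: mA.
  - by have := H _ _ Ay; rewrite !pairE; lra.
  - exact: H.
  - by rewrite pairBl subrr.
split; first by move=> [y ys] /= Ay; left.
by move=> /(_ (x, xs)) /= BA; apply/nA/BA; right.
Qed.

Section rockafellar.
Context {R : realType} {X : completeNormedModType R}.
Hypotheses (HX : uniformly_convex X) (HXs : uniformly_convex (dual X)).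
Variable A : X -> set (dual X).
Hypothesis mA : monotone_op A.
Hypothesis maxA : forall x xs,
  (forall y ys, A y ys -> 0 <= ((xs - ys) (x - y) : R)) -> A x xs.

(* The epigraph of the Fitzpatrick function of [A]; working with it avoids the
   value [+oo] of that function. *)
Let E (y : X) (ys : dual X) (r : R) :=
  forall z zs, A z zs -> (zs y : R) + ys z - zs z <= r.

Let Phi (y : X) (ys : dual X) (r : R) : R :=
  r + `|y| ^+ 2 / 2 + `|ys| ^+ 2 / 2.

(** Fitzpatrick's inequality: if [r < ys y], then [(y, ys)] is monotonically related to the graph,
    hence belongs to it, and [E] tested at [(y, ys)] itself gives [ys y <= r]. *)
Let E_ge y ys r : E y ys r -> (ys y : R) <= r.
Proof.
move=> Er; rewrite leNgt; apply/negP => rlt.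
suff /Er : A y ys by lra.
apply: maxA => z zs Az; have := Er _ _ Az; rewrite !pairE.
move: (zs y : R) (ys z : R) (zs z : R) (ys y : R) rlt => *; lra.
Qed.

Let E_graph z zs : A z zs -> E z zs (zs z).
Proof.
move=> Az y ys Ay; have := mA Az Ay; rewrite !pairE.
move: (ys z : R) (zs y : R) (zs z : R) (ys y : R) => *; lra.
Qed.

Let E_convex y ys r z zs q (s : R) : 0 <= s -> s <= 1 ->
  E y ys r -> E z zs q ->
  E (y + s *: (z - y)) (ys + s *: (zs - ys)) (r + s * (q - r)).
Proof.
move=> s0 s1 Ey Ez u us Au; have := Ey _ _ Au; have := Ez _ _ Au; rewrite !pairE.
move: (us z : R) (us y : R) (ys u : R) (zs u : R) (us u : R) => *; nra.
Qed.

(** The direct method: a graph point bounds [r] below by an affine function, so minimizing sequences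
    are bounded, and uniform convexity of both spaces makes them Cauchy. *)
Let Phi_min (x0 : X) (xs0 : dual X) : A x0 xs0 ->
  exists y ys r, E y ys r /\ forall z zs q, E z zs q -> Phi y ys r <= Phi z zs q.
Proof.
move=> A0.
pose V := [set Phi p.1.1 p.1.2 p.2 |
  p in [set p : X * dual X * R | E p.1.1 p.1.2 p.2]].
have Vlb : has_lbound V.
  exists 0 => _ [[[y ys] r] /= /E_ge Er <-]; have := pair_ge ys y; rewrite /Phi.
  have := sqr_ge0 (`|y| - `|ys|); move: (ys y : R) Er; rewrite !expr2 => *; nra.
have V0 : V !=set0.
  by exists (Phi x0 xs0 (xs0 x0)), (x0, xs0, xs0 x0 : R) => //=; exact: E_graph.
pose m := inf V.
have mle y ys r : E y ys r -> m <= Phi y ys r.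
  by move=> Er; apply: ge_inf => //; exists (y, ys, r).
have : forall n, exists p : X * dual X * R, E p.1.1 p.1.2 p.2 /\
    Phi p.1.1 p.1.2 p.2 <= m + n.+1%:R^-1.
  move=> n; have h0 : 0 < n.+1%:R^-1 :> R by rewrite invr_gt0.
  have [_ [p Ep <-] pm] := inf_adherent h0 (conj V0 Vlb).
  by exists p; split => //; exact: ltW.
move=> /choice[p pP].
pose y n := (p n).1.1; pose ys n := (p n).1.2; pose r n := (p n).2.
have Ep n : E (y n) (ys n) (r n) by case: (pP n).
have Pm n : Phi (y n) (ys n) (r n) <= m + n.+1%:R^-1 by case: (pP n).
have [M M0 bnd] : exists2 M : R, 0 < M & forall n, `|y n| <= M /\ `|ys n| <= M.
  pose al := `|xs0|; pose be := `|x0|.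
  have al0 : 0 <= al by exact: normr_ge0.
  have be0 : 0 <= be by exact: normr_ge0.
  (* [Q] is what remains after completing the squares in [|y n| - al] and [|ys n| - be]. *)
  pose Q := `|m| + 1 + al * be + al ^+ 2 / 2 + be ^+ 2 / 2 .
  have mQ := ler_norm m; have m0 := normr_ge0 m.
  have ab0 := mulr_ge0 al0 be0; have a20 := sqr_ge0 al; have b20 := sqr_ge0 be.
  have Q0 : 0 <= Q by rewrite /Q; lra.
  exists (al + be + Q + 1); first by lra.
  move=> n; have h1 : n.+1%:R^-1 <= 1 :> R by rewrite invf_le1// ler1n.
  have := Pm n; have := Ep n _ _ A0; rewrite /Phi.
  have := pair_ge xs0 (y n); have := pair_ge (ys n) x0; have := pair_le xs0 x0.
  rewrite -/al -/be.
  have y0 := normr_ge0 (y n); have ys0 := normr_ge0 (ys n).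
  move: (n.+1%:R^-1) h1 => h h1.
  move: (xs0 x0 : R) (xs0 (y n) : R) (ys n x0 : R) => a b c ha hc hb hE hP.
  have S : (`|y n| - al) ^+ 2 / 2 + (`|ys n| - be) ^+ 2 / 2 <= Q.
    by move: hb hc hP ha mQ; rewrite /Q !expr2; lra.
  have q1 := sqr_ge0 (`|y n| - al); have q2 := sqr_ge0 (`|ys n| - be).
  have q3 := sqr_ge0 (`|y n| - al - 1); have q4 := sqr_ge0 (`|ys n| - be - 1).
  by move: q1 q2 q3 q4 S; rewrite !expr2; split; nra.
have gap (e : R) : 0 < e -> exists N, forall n k, (N <= n)%N -> (N <= k)%N ->
    `|y n - y k| <= e /\ `|ys n - ys k| <= e.
  move=> e0.
  have [d1 d10 H1] := uniformly_convex_sq HX M0 e0.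
  have [d2 d20 H2] := uniformly_convex_sq HXs M0 e0.
  (* Comparing the value at the midpoint with [m], the two parallelogram defects add up to at most 4
     times the sum of the two excesses; the factor 1/8 puts this below both [d1] and [d2]. *)
  have [N HN] : exists N, forall n, (N <= n)%N ->
      n.+1%:R^-1 < (Num.min d1 d2) / 8.
    by apply: harmonic_lt; rewrite divr_gt0// lt_min d10.
  exists N => n k Nn Nk.
  have hn := HN _ Nn; have hk := HN _ Nk.
  have h02 : 0 <= 1 / 2 :> R by lra.
  have h12 : 1 / 2 <= 1 :> R by lra.
  have := mle _ _ _ (E_convex h02 h12 (Ep n) (Ep k)).
  have midE (W : lmodType R) (a b : W) :
      a + (1 / 2) *: (b - a) = 2^-1 *: (a + b).
    rewrite div1r scalerBr scalerDr addrCA addrC; congr (_ + _).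
    by rewrite -{1}[a]scale1r -scalerBl; congr (_ *: _); lra.
  rewrite /Phi (midE X) (midE (dual X)) !normrZ ger0_norm ?invr_ge0// => mid.
  have := Pm n; have := Pm k; rewrite /Phi.
  have D1 : `|y n + y k| ^+ 2 <= 2 * `|y n| ^+ 2 + 2 * `|y k| ^+ 2.
    have := ler_normD (y n) (y k); have := normr_ge0 (y n + y k).
    by have := sqr_ge0 (`|y n| - `|y k|); rewrite !expr2; nra.
  have D2 : `|ys n + ys k| ^+ 2 <= 2 * `|ys n| ^+ 2 + 2 * `|ys k| ^+ 2.
    have := ler_normD (ys n) (ys k); have := normr_ge0 (ys n + ys k).
    by have := sqr_ge0 (`|ys n| - `|ys k|); rewrite !expr2; nra.
  have [yn ysn] := bnd n; have [yk ysk] := bnd k.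
  have md1 : Num.min d1 d2 <= d1 by rewrite ge_min lexx.
  have md2 : Num.min d1 d2 <= d2 by rewrite ge_min lexx orbT.
  have {}H1 := H1 _ _ yn yk; have {}H2 := H2 _ _ ysn ysk.
  move: (n.+1%:R^-1) (k.+1%:R^-1) (Num.min d1 d2) hn hk md1 md2 mid
    => hn hk mn Hn Hk md1 md2.
  rewrite !exprMn.
  move: (`|y n + y k| ^+ 2) (`|y n| ^+ 2) (`|y k| ^+ 2) D1 H1 => a1 b1 c1 D1 H1.
  move: (`|ys n + ys k| ^+ 2) (`|ys n| ^+ 2) (`|ys k| ^+ 2) D2 H2
    => a2 b2 c2 D2 H2.
  rewrite expr2 => mid P1 P2.
  split; rewrite leNgt; apply/negP => /ltW.
    by move=> /H1 {H1 H2}; lra.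
  by move=> /H2 {H1 H2}; lra.
have [Y yY] : exists Y : X, y n @[n --> \oo] --> Y.
  apply: cauchy_seq_cvg => e /gap[N HN]; exists N => n k Nn Nk.
  by case: (HN _ _ Nn Nk).
have [Ys ysYs] : exists Ys : dual X, ys n @[n --> \oo] --> Ys.
  apply: cauchy_seq_cvg => e /gap[N HN]; exists N => n k Nn Nk.
  by case: (HN _ _ Nn Nk).
(* The height is solved from [Phi = m] instead of being obtained as a limit of [r]. *)
exists Y, Ys, (m - `|Y| ^+ 2 / 2 - `|Ys| ^+ 2 / 2); split; last first.
  by move=> z zs q /mle; rewrite {2}/Phi; rewrite /Phi; lra.
move=> z zs Az.
apply: (@ler_lim_seq _ (fun n => (zs (y n) : R) + ys n z - zs z)
  (fun n => m + n.+1%:R^-1 - `|y n| ^+ 2 / 2 - `|ys n| ^+ 2 / 2)).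
- apply: cvgB; last exact: cvg_cst.
  by apply: cvgD; [exact: cvg_pairr|exact: cvg_pairl].
- apply: cvgB; first apply: cvgB.
  + rewrite -[X in _ --> X]addr0; apply: cvgD; first exact: cvg_cst.
    exact: cvg_harmonic.
  + apply: cvgMl; under eq_fun do rewrite expr2; rewrite expr2.
    by apply: cvgM; exact: cvg_norm.
  + apply: cvgMl; under eq_fun do rewrite expr2; rewrite expr2.
    by apply: cvgM; exact: cvg_norm.
- move=> n; have := Pm n; have := Ep n _ _ Az; rewrite /Phi.
  by move: (_ + _ - _) (n.+1%:R^-1) => a h; lra.
Qed.

(* First-order optimality of a minimizer [(y, ys, r)] of [Phi] over [E]: with
   [j], [js] the images of [y], [ys] under the duality maps, [(- js, - j)] is
   monotonically related to the graph of [A]. *)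
Theorem resolvent_at0 (x0 : X) (xs0 : dual X) : A x0 xs0 ->
  exists p ps, A p ps /\ (ps p : R) + `|p| ^+ 2 / 2 + `|ps| ^+ 2 / 2 <= 0.
Proof.
move=> /Phi_min[y [ys [r [Er minr]]]].
have [J JE Jn] : exists2 J : X -> dual X, forall z, (J z z : R) = `|z| ^+ 2 &
    forall z, `|J z| = `|z|.
  have /choice[J HJ] : forall z : X, exists f : dual X,
      (f z : R) = `|z| ^+ 2 /\ `|f| = `|z|.
    by move=> z; have [f ? ?] := norming_functional z; exists f.
  by exists J => z; case: (HJ z).
have [K KE Kn] : exists2 K : dual X -> X,
    forall f : dual X, (f (K f) : R) = `|f| ^+ 2 &
    forall f, `|K f| = `|f|.
  have /choice[K HK] : forall f : dual X, exists z : X,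
      (f z : R) = `|f| ^+ 2 /\ `|z| = `|f|.
    by move=> f; have [z ? ?] := norming_vector f HX; exists z.
  by exists K => z; case: (HK z).
(* The variational inequality: move from the minimizer towards the graph point [(z, zs)] at height
   [zs z], divide by the step and let it tend to 0. *)
have opt z zs : A z zs ->
    0 <= (zs z : R) - r + J y (z - y) + (zs - ys) (K ys).
  move=> Az; pose s n : R := n.+1%:R^-1.
  have s0 n : 0 < s n by rewrite invr_gt0.
  have s1 n : s n <= 1 by rewrite invf_le1// ler1n.
  pose yn n := y + s n *: (z - y); pose ysn n := ys + s n *: (zs - ys).
  have cs (W : normedModType R) (a d : W) : a + s n *: d @[n --> \oo] --> a.
    rewrite -[X in _ --> X]addr0 -(scale0r d).
    by apply: cvgD; [exact: cvg_cst|apply: cvgZr_tmp; exact: cvg_harmonic].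
  have cJ : J (yn n) @[n --> \oo] --> J y.
    apply: (@duality_map_cvg _ _ _ (fun (f : dual X) x => f x) _ yn _ y) => //.
    - by move=> f a b; rewrite pairBr.
    - by move=> f a; exact: dual_norm_pairing.
    - exact: cs.
  have cK : K (ysn n) @[n --> \oo] --> K ys.
    apply: (@duality_map_cvg _ _ _ (fun x (f : dual X) => f x) _ ysn _ ys) => //.
    - by move=> a b f; rewrite pairDr.
    - by move=> a f; rewrite mulrC; exact: dual_norm_pairing.
    - exact: cs.
  apply: (@ler_lim_seq _ (fun=> 0)
    (fun n => (zs z : R) - r + J (yn n) (z - y) + (zs - ys) (K (ysn n)))).
  - exact: cvg_cst.
  - apply: cvgD; last exact: cvg_pairr.
    by apply: cvgD; [exact: cvg_cst|exact: cvg_pairl].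
  - move=> n.
    have := minr _ _ _ (E_convex (ltW (s0 n)) (s1 n) Er (E_graph Az)).
    rewrite -/(yn n) -/(ysn n) /Phi.
    (* The subgradient inequality is taken at the moved point, whence the need for continuity of
       [J], and likewise of [K]. *)
    have dJ : `|yn n| ^+ 2 / 2 - `|y| ^+ 2 / 2 <= s n * J (yn n) (z - y).
      have := JE (yn n); rewrite {2}/yn pairDr pairZr.
      have := pair_le (J (yn n)) y; rewrite Jn.
      have := sqr_ge0 (`|yn n| - `|y|); rewrite !expr2; nra.
    have dK : `|ysn n| ^+ 2 / 2 - `|ys| ^+ 2 / 2 <= s n * (zs - ys) (K (ysn n)).
      have := KE (ysn n); rewrite {1}/ysn pairDl pairZl.
      have := pair_le ys (K (ysn n)); rewrite Kn.
      have := sqr_ge0 (`|ysn n| - `|ys|); rewrite !expr2; nra.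
    move=> H; rewrite -(pmulr_rge0 _ (s0 n)).
    move: (J (yn n) (z - y) : R) ((zs - ys) (K (ysn n)) : R) dJ dK H => a b.
    move: (zs z : R) (s n) => c t; nra.
have key z zs : A z zs -> r + `|y| ^+ 2 + `|ys| ^+ 2 + J y (K ys) <=
    (zs - - J y) (z - - K ys).
  move=> /opt; have := JE y; have := KE ys; rewrite !opprK !pairE.
  move: (J y z : R) (zs z : R) (J y y : R) (zs (K ys) : R) (ys (K ys) : R) => *.
  lra.
have rge := E_ge Er.
have lb := pair_ge ys y; have lb2 := pair_ge (J y) (K ys).
rewrite Jn Kn in lb2.
have q := sqr_ge0 (`|y| - `|ys|).
(* The left side of [key] is at least [(|y| - |ys|)^2]. Once the point is in the graph, testing
   [key] at that point makes the right side vanish. *)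
have Ap : A (- K ys) (- J y).
  apply: maxA => z zs /key; rewrite !opprK !pairE.
  move: (J y z : R) (zs z : R) (zs (K ys) : R) => b c d H.
  move: (J y (K ys) : R) (ys y : R) q lb lb2 rge H; rewrite !expr2 => *; nra.
exists (- K ys), (- J y); split => //; have := key _ _ Ap.
rewrite subrr pairE !normrN Jn Kn !pairE.
move: (J y (K ys) : R) (ys y : R) q lb lb2 rge; rewrite !expr2 => *; nra.
Qed.

End rockafellar.

(** * Values, faces and resolvents of a maximal monotone operator *)

Section maximal_monotone.
Context {R : realType} {X : completeNormedModType R}.
Hypotheses (HX : uniformly_convex X) (HXs : uniformly_convex (dual X)).
Variable A : X -> set (dual X).
Hypothesis HA : maximal_monotone_op A.

Let mem x (xs : dual X) :
  (forall y ys, A y ys -> (ys (x - y) : R) <= xs (x - y)) -> A x xs.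
Proof.
move=> H; apply: (maximal_monotone_mem HA) => y ys /H.
by rewrite pairBl subr_ge0.
Qed.

Let memP x y (xs ys : dual X) :
  A x xs -> A y ys -> (ys (x - y) : R) <= xs (x - y).
Proof.
move=> Ax Ay; have := proj1 HA _ _ _ _ Ax Ay; by rewrite pairBl subr_ge0.
Qed.

Lemma maximal_monotone_midpoint x a b :
  A x a -> A x b -> A x (2^-1 *: (a + b)).
Proof.
move=> Aa Ab; apply: mem => y ys Ay.
have := memP Aa Ay; have := memP Ab Ay; rewrite pairZl pairDl.
by move: (ys _ : R) (a _ : R) (b _ : R) => *; lra.
Qed.

Lemma maximal_monotone_closed x (u : nat -> dual X) (l : dual X) :
  (forall n, A x (u n)) -> u n @[n --> \oo] --> l -> A x l.
Proof.
move=> Au ul; apply: mem => y ys Ay.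
apply: (ler_lim_seq _ (cvg_pairl (x := x - y) ul)); first exact: cvg_cst.
by move=> n; exact: memP.
Qed.

Lemma op_faceP x v (b : dual X) :
  op_face A x v b <-> A x b /\ forall ys, A x ys -> (ys v : R) <= b v.
Proof.
split=> [[Ab bE]|[Ab bmax]]; split => //.
  by move=> ys Ay; rewrite -lee_fin bE; apply: ereal_sup_ubound; exists ys.
apply/eqP; rewrite eq_le; apply/andP; split.
  by apply: ereal_sup_ubound; exists b.
by apply: ge_ereal_sup => _ [ys Ay <-]; rewrite lee_fin bmax.
Qed.

(** Values of [A] are closed and convex, so the default of [min_norm_sel] is never taken on the
    domain. *)
Lemma min_norm_selP x : op_dom A x -> min_norm (A x) (min_norm_sel A x).
Proof.
move=> Dx; apply: xgetPex.
have [||c Ac cmin] := @min_norm_exists _ _ HXs (A x) Dx.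
- exact: maximal_monotone_midpoint.
- exact: maximal_monotone_closed.
by exists c.
Qed.

Lemma min_norm_op_face x v : op_face A x v !=set0 ->
  exists2 b, op_face A x v b & forall a, op_face A x v a -> `|b| <= `|a|.
Proof.
move=> F0; apply: (min_norm_exists HXs F0).
  move=> a b /op_faceP[Aa amax] /op_faceP[Ab bmax]; apply/op_faceP; split.
    exact: maximal_monotone_midpoint.
  move=> ys Ay; have := amax _ Ay; have := bmax _ Ay; rewrite pairZl pairDl.
  by move: (ys _ : R) (a _ : R) (b _ : R) => *; lra.
move=> u l uF ul; apply/op_faceP; split.
  by apply: (maximal_monotone_closed _ ul) => n; case/op_faceP: (uF n).
move=> ys Ay; apply: (ler_lim_seq _ (cvg_pairl (x := v) ul)).
  exact: cvg_cst.
by move=> n; case/op_faceP: (uF n) => _; exact.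
Qed.

(** The inequality is the Fenchel form of [- la a = J (y - u)]. It comes from the case of the
    origin, applied to [A] translated by [u] and scaled by [la]. *)
Lemma resolvent x0 (u : X) (la : R) : op_dom A x0 -> 0 < la ->
  exists y a, A y a /\
    la * a (y - u) + `|y - u| ^+ 2 / 2 + (la * `|a|) ^+ 2 / 2 <= 0.
Proof.
move=> [xs0 Ax0] la0.
have laK (f : dual X) : la^-1 *: (la *: f) = f.
  by rewrite scalerA mulVf ?gt_eqF// scale1r.
pose B z : set (dual X) := [set zs | A (u + z) (la^-1 *: zs)].
have mB : monotone_op B.
  move=> z z' zs zs' Bz Bz'; have := proj1 HA _ _ _ _ Bz Bz'.
  by rewrite -scalerBr pairZl opprD addrACA subrr add0r pmulr_rge0// invr_gt0.
have maxB z (zs : dual X) :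
    (forall y ys, B y ys -> 0 <= ((zs - ys) (z - y) : R)) -> B z zs.
  move=> H; apply: (maximal_monotone_mem HA) => y ys Ay.
  have h : 0 <= ((zs - la *: ys) (u + z - y) : R).
    have -> : u + z - y = z - (y - u) by rewrite opprB addrCA addrA.
    by apply: H; rewrite /B/= laK addrC subrK.
  have -> : la^-1 *: zs - ys = la^-1 *: (zs - la *: ys) by rewrite scalerBr laK.
  by rewrite pairZl mulr_ge0// invr_ge0 ltW.
have B0 : B (x0 - u) (la *: xs0) by rewrite /B/= laK addrC subrK.
have [p [ps [Bp pE]]] := resolvent_at0 HX HXs mB maxB B0.
exists (u + p), (la^-1 *: ps); split => //.
have -> : u + p - u = p by rewrite addrC addKr.
rewrite pairZl mulrA divff ?gt_eqF// mul1r normrZ mulrA.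
by rewrite gtr0_norm ?invr_gt0// divff ?gt_eqF// mul1r.
Qed.

(* A substitute for the weak compactness of balls that only needs uniform
   convexity. *)
Lemma halfspaces_compact (H : X -> R -> R -> Prop) (M : R) :
  (forall z c d, H z c d -> 0 <= c) ->
  (forall n, exists2 a : dual X,
    forall z c d, H z c d -> d - c * n.+1%:R^-1 <= a z & `|a| <= M) ->
  exists2 a : dual X, forall z c d, H z c d -> d <= a z & `|a| <= M.
Proof.
move=> H0 Hn.
pose C n := [set a : dual X |
  forall z c d, H z c d -> d - c * n.+1%:R^-1 <= a z].
have [||||a aC aM] := @nested_convex _ _ HXs C M.
- move=> n k nk a Ca z c d Hz; apply: le_trans (Ca _ _ _ Hz).
  rewrite lerD2l lerN2 ler_wpM2l ?(H0 _ _ _ Hz)//.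
  by rewrite lef_pV2 ?posrE// ler_nat.
- move=> n a b Ca Cb z c d Hz; have := Ca _ _ _ Hz; have := Cb _ _ _ Hz.
  by rewrite pairZl pairDl; move: (d - _) (a z : R) (b z : R) => *; lra.
- move=> n u l Cu ul z c d Hz.
  apply: (ler_lim_seq _ (cvg_pairl (x := z) ul)); first exact: cvg_cst.
  by move=> k; exact: Cu.
- exact: Hn.
exists a => // z c d Hz.
apply: (@ler_lim_seq _ (fun n => d - c * n.+1%:R^-1) (fun=> a z : R)).
- rewrite -[X in _ --> X]subr0 -(mulr0 c); apply: cvgB; first exact: cvg_cst.
  by apply: cvgMr; exact: cvg_harmonic.
- exact: cvg_cst.
- by move=> n; exact: aC.
Qed.

(** Otherwise some bounded functionals, taken at points tending to [x], violate the bound; in the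
    limit they give an element of [A x] whose value at [v] is at least [b v + d], against the choice
    of [b] in the face. *)
Lemma op_face_usc x v b (K d : R) : op_face A x v b -> 0 < d -> 0 <= K ->
  exists2 e : R, 0 < e & forall y a, A y a -> `|y - x| <= e -> `|a| <= K ->
    (a v : R) <= b v + d.
Proof.
move=> /op_faceP[Ab bmax] d0 K0; apply: contrapT => nH.
have bad n : exists y a, [/\ A y a, `|y - x| <= n.+1%:R^-1, `|a| <= K &
    b v + d < (a v : R)].
  apply: contrapT => H; apply: nH; exists n.+1%:R^-1; first by rewrite invr_gt0.
  move=> y a Ay yx aK; rewrite leNgt; apply/negP => lt; apply: H.
  by exists y, a.
(* The first family of half-spaces cuts out [A x] by maximality; its slack [K + |ys|] bounds
   [|a - ys|], the cost of replacing [y] by [x]. The second is the violated bound, kept exactly. *)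
pose H z c r := (exists y ys, [/\ A y ys, z = x - y, c = K + `|ys| &
   r = ys (x - y)]) \/ [/\ z = v, c = 0 & r = b v + d].
have [||a aH _] := @halfspaces_compact H K.
- by move=> z c r [[y [ys [_ _ -> _]]]|[_ -> _]]//; rewrite addr_ge0.
- move=> n; have [y [a [Ay yx aK /ltW av]]] := bad n; exists a => //.
  move=> z c r [[z' [zs [Az -> -> ->]]]|[-> -> ->]]; last by rewrite mul0r subr0.
  have := memP Ay Az; have := pair_ge (a - zs) (x - y).
  have -> : x - z' = (x - y) + (y - z') by rewrite addrA subrK.
  rewrite (pairDr _ (x - y)) (pairDr _ (x - y)) pairBl (distrC x y).
  have : `|a - zs| * `|y - x| <= (K + `|zs|) * n.+1%:R^-1.
    apply: ler_pM => //; rewrite (le_trans (ler_normB _ _))// lerD2r//.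
  move: (_ * _) (_ * _) (zs (x - y) : R) (a (x - y) : R) (zs _ : R) (a _ : R).
  by move=> *; lra.
have Aa : A x a.
  by apply: mem => y ys Ay; apply: (aH _ (K + `|ys|)); left; exists y, ys.
have := aH v 0 (b v + d) (or_intror (And3 erefl erefl erefl)).
by have := bmax _ Aa; lra.
Qed.

(** Otherwise the midpoints of [a] and [b], of norm below [|b| - d / 2], yield in the limit an
    element of the face shorter than [b]. The sum [a + b] is the quantity that uniform convexity
    controls. *)
Lemma op_face_norm_lsc x v b (K d : R) : op_face A x v b ->
  (forall a, op_face A x v a -> `|b| <= `|a|) -> 0 < d -> 0 <= K ->
  exists2 e : R, 0 < e & forall t w a, 0 < t -> t <= e -> `|w - v| <= e ->
    A (x + t *: w) a -> `|a| <= K -> 2 * `|b| - d <= `|a + b|.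
Proof.
move=> Fb bmin d0 K0; apply: contrapT => nH.
have [Ab bmax] := (proj1 (op_faceP _ _ _)) Fb.
have bad n : exists t w a, [/\ 0 < t, t <= n.+1%:R^-1, `|w - v| <= n.+1%:R^-1,
    A (x + t *: w) a & `|a| <= K /\ `|a + b| < 2 * `|b| - d].
  apply: contrapT => H; apply: nH; exists n.+1%:R^-1; first by rewrite invr_gt0.
  move=> t w a t0 tn wv Aa aK; rewrite leNgt; apply/negP => lt; apply: H.
  by exists t, w, a.
pose G := `|v| + 1.
have G0 : 0 <= G by rewrite addr_ge0.
pose H z c r := exists ys, c = (K + `|ys|) * G /\
  ((exists y, [/\ A y ys, z = x - y & r = ys (x - y)]) \/
   [/\ A x ys, z = v & r = ys v]).
have [||a aH aM] := @halfspaces_compact H (`|b| - d / 2).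
- by move=> z c r [ys [-> _]]; rewrite mulr_ge0// addr_ge0.
- move=> n; have [t [w [a [t0 tn wv Aa [aK lt]]]]] := bad n.
  have h0 : 0 <= n.+1%:R^-1 :> R by [].
  have h1 : n.+1%:R^-1 <= 1 :> R by rewrite invf_le1// ler1n.
  have wG : `|w| <= G.
    rewrite -(subrK v w) (le_trans (ler_normD _ _))// /G addrC lerD2l.
    exact: le_trans wv h1.
  exists (2^-1 *: (a + b)); last by rewrite normrZ ger0_norm ?invr_ge0//; lra.
  move=> z c r [ys [-> zr]]; rewrite pairZl pairDl.
  have nays : `|a - ys| <= K + `|ys|.
    by rewrite (le_trans (ler_normB _ _))// lerD2r.
  have : 0 <= (K + `|ys|) * G * n.+1%:R^-1 by rewrite !mulr_ge0// addr_ge0.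
  case: zr => [[y [Ay -> ->]]|[Ay -> ->]].
    have := memP Aa Ay; have := memP Ab Ay; have := pair_le (a - ys) (t *: w).
    have : `|a - ys| * `|t *: w| <= (K + `|ys|) * G * n.+1%:R^-1.
      rewrite -mulrA; apply: ler_pM => //.
      by rewrite normrZ gtr0_norm// mulrC; apply: ler_pM => //; exact: ltW.
    have -> : x + t *: w - y = (x - y) + t *: w by rewrite addrAC.
    rewrite (pairDr _ (x - y)) (pairDr _ (x - y)) pairBl.
    move: (`|a - ys| * _) ((K + _) * G * _) => p q.
    move: (ys (x - y) : R) (a (x - y) : R) (b (x - y) : R) => a1 a2 a3.
    by move: (ys (t *: w) : R) (a (t *: w) : R) => a4 a5 *; lra.
  (* Monotonicity between [x + t *: w] and [x], divided by [t], gives the face condition in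
     direction [w]; the slack pays for passing to [v]. *)
  have := memP Aa Ay; rewrite addrC addKr !pairZr ler_pM2l// => ysw.
  have := bmax _ Ay; have := pair_le (a - ys) (w - v).
  have : `|a - ys| * `|w - v| <= (K + `|ys|) * G * n.+1%:R^-1.
    rewrite -mulrA; apply: ler_pM => //; rewrite (le_trans wv)// ler_peMl//.
    by rewrite lerDr.
  rewrite pairBl !pairBr.
  move: (`|a - ys| * _) ((K + _) * G * _) => p q.
  move: (ys w : R) (a w : R) ysw => a1 a2 ysw.
  by move: (ys v : R) (a v : R) (b v : R) => a4 a5 a6 *; lra.
have Aa : A x a.
  apply: mem => y ys Ay; apply: (aH _ ((K + `|ys|) * G)); exists ys; split => //.
  by left; exists y.
have /bmin : op_face A x v a.
  apply/op_faceP; split => // ys Ay; apply: (aH _ ((K + `|ys|) * G)).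
  by exists ys; split => //; right.
by lra.
Qed.

End maximal_monotone.

(** * Construction of a sequence realizing the limsup *)

Section directional.
Context {R : realType} {X : completeNormedModType R}.
Hypotheses (HX : uniformly_convex X) (HXs : uniformly_convex (dual X)).
Variable A : X -> set (dual X).
Hypothesis HA : maximal_monotone_op A.

(* [x + t w] is the resolvent of [A] of parameter [t c] at [x + t v]; then
   [a = J (v - w) / c], so that a bound on [a] independent of [c] makes [w] as
   close to [v] as desired. *)
Lemma scaled_resolvent x v b (c t : R) : A x b -> 0 < c -> 0 < t ->
  exists w a, [/\ A (x + t *: w) a, `|w - v| = c * `|a| &
    c * `|a| ^+ 2 <= a v - b v + `|b| * (c * `|a|)].
Proof.
move=> Ab c0 t0.
have [y [a [Aa res]]] : exists y a, A y a /\ (t * c) * a (y - (x + t *: v)) +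
    `|y - (x + t *: v)| ^+ 2 / 2 + ((t * c) * `|a|) ^+ 2 / 2 <= 0.
  by apply: (resolvent HX HXs HA _ (x0 := x)); [exists b|rewrite mulr_gt0].
pose w := t^-1 *: (y - x).
have yE : y = x + t *: w.
  by rewrite scalerA divff ?gt_eqF// scale1r addrC subrK.
have yuE : y - (x + t *: v) = t *: (w - v).
  by rewrite yE opprD addrACA subrr add0r scalerBr.
move: res; rewrite yuE pairZr normrZ gtr0_norm// => res.
have {}res : c * a (w - v) + `|w - v| ^+ 2 / 2 + (c * `|a|) ^+ 2 / 2 <= 0.
  rewrite -(pmulr_rle0 _ (exprn_gt0 2 t0)); move: res; rewrite !expr2.
  by move: (a (w - v) : R) => *; lra.
have low := pair_ge a (w - v); have blow := pair_ge b (w - v).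
(* Bounding [a (w - v)] below by [- |a| * |w - v|] turns [res] into [(|w - v| - c * |a|)^2 <= 0]. *)
have wv : `|w - v| = c * `|a|.
  apply/eqP; rewrite -subr_eq0 -sqrf_eq0 eq_le sqr_ge0 andbT.
  by move: (a (w - v) : R) res low; rewrite !expr2 => *; nra.
exists w, a; split; rewrite -?yE//.
have := proj1 HA _ _ _ _ Aa Ab.
have -> : y - x = t *: w by rewrite yE addrC addKr.
rewrite pairZr pmulr_rge0// pairBl.
rewrite wv in res blow.
have -> : w = v + (w - v) by rewrite addrC subrK.
rewrite (pairDr a) (pairDr b).
move: (a (w - v) : R) (b (w - v) : R) res blow => aw bw.
rewrite !expr2 => res blow h.
have : c * (aw + c * (`|a| * `|a|)) <= 0 by lra.
rewrite pmulr_rle0// => h2.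
lra.
Qed.

(** The order of choices matters: [c] is fixed by [e], which bounds [|a|] by [2 * G] uniformly in
    [t]; only then is [t] taken small enough for [op_face_usc] at that bound. *)
Lemma approximate_direction x v b (e : R) : op_face A x v b -> 0 < e ->
  exists t w a, [/\ 0 < t, t <= e, `|w - v| <= e, A (x + t *: w) a &
    `|a| <= `|b| + e].
Proof.
move=> Fb e0; have [Ab bmax] := (proj1 (op_faceP _ _ _ _)) Fb.
have b0 := normr_ge0 b; have v0 := normr_ge0 v.
pose c := e / (`|b| + e).
have be0 : 0 < `|b| + e by lra.
have c0 : 0 < c by rewrite divr_gt0.
have cE : c * (`|b| + e) = e by rewrite divfK ?gt_eqF.
pose G := `|v| / c + `|b|.
have cG : c * G = `|v| + c * `|b| by rewrite mulrDr mulrCA divff ?gt_eqF// mulr1.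
have G0 : 0 <= G by rewrite addr_ge0// divr_ge0// ltW.
have G2 : 0 <= 2 * G by rewrite mulr_ge0.
(* With this tolerance, dividing by [c] leaves [|a|^2 <= e^2 + |b| * |a|], which forces
   [|a| <= |b| + e]. *)
have ce0 : 0 < c * e ^+ 2 by rewrite mulr_gt0// exprn_gt0.
have [e1 e10 usc] := op_face_usc HXs HA Fb ce0 G2.
have D0 : 0 < `|v| + c * (2 * G) + 1.
  by rewrite ltr_wpDl// addr_ge0// mulr_ge0// ltW.
pose t := Num.min e (e1 / (`|v| + c * (2 * G) + 1)).
have t0 : 0 < t by rewrite lt_min e0 divr_gt0.
have te : t <= e by rewrite ge_min lexx.
have te1 : t * (`|v| + c * (2 * G) + 1) <= e1.
  by rewrite -ler_pdivlMr// ge_min lexx orbT.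
have [w [a [Aa wv cb]]] := scaled_resolvent v Ab c0 t0.
have a0 := normr_ge0 a.
have aG : `|a| <= 2 * G.
  have bG : `|b| <= G by rewrite lerDr divr_ge0// ltW.
  have : c * `|a| ^+ 2 <= c * (G * `|a|) + c * G * `|b|.
    rewrite mulrA cG.
    have := pair_le a v; have := pair_ge b v.
    move: (a v : R) (b v : R) cb => av bv; rewrite expr2 => cb h1 h2.
    by have := mulr_ge0 (mulr_ge0 (ltW c0) b0) b0; nra.
  rewrite -mulrA -mulrDr ler_pM2l// expr2.
  by move=> h; rewrite leNgt; apply/negP => lt; nra.
have yx : `|x + t *: w - x| <= e1.
  rewrite addrC addKr normrZ gtr0_norm// (le_trans _ te1)// ler_wpM2l ?ltW//.
  have := ler_normD (w - v) v; rewrite subrK wv.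
  have : c * `|a| <= c * (2 * G) by rewrite ler_pM2l.
  lra.
have av := usc _ _ Aa yx aG.
have ae : `|a| <= `|b| + e.
  have : c * `|a| ^+ 2 <= c * (e ^+ 2 + `|b| * `|a|).
    by move: (a v : R) (b v : R) cb av; rewrite !expr2 => *; lra.
  rewrite ler_pM2l// !expr2 => h; rewrite leNgt; apply/negP => lt; nra.
exists t, w, a; split => //.
by rewrite wv -cE ler_pM2l.
Qed.

Lemma w_limsup_nonempty x v : op_face A x v !=set0 -> w_limsup A x v !=set0.
Proof.
move=> /(min_norm_op_face HXs HA)[b Fb bmin].
have : forall n, exists p : R * X, [/\ 0 < p.1, p.1 <= n.+1%:R^-1,
    `|p.2 - v| <= n.+1%:R^-1, op_dom A (x + p.1 *: p.2) &
    `|min_norm_sel A (x + p.1 *: p.2)| <= `|b| + n.+1%:R^-1].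
  move=> n; have h0 : 0 < n.+1%:R^-1 :> R by rewrite invr_gt0.
  have [t [w [a [t0 tn wv Aa an]]]] := approximate_direction Fb h0.
  have Dt : op_dom A (x + t *: w) by exists a.
  exists (t, w); split => //=; apply: le_trans an.
  by have [_] := min_norm_selP HXs HA Dt; exact.
move=> /choice[p pP].
pose t n := (p n).1; pose w n := (p n).2.
pose al n := min_norm_sel A (x + t n *: w n).
have L0 := normr_ge0 b.
have alb : al n @[n --> \oo] --> b.
  apply/cvgrPdist_le => e e0.
  have L1 : 0 < `|b| + 1 by lra.
  have [d d0 Hd] := uniformly_convex_sq HXs L1 e0.
  (* The defect of [b] and [al n] is at most [8 * |b| * h + 2 * h], which this [h] keeps below
     [d]. *)
  pose h := d / (16 * (`|b| + 1)).
  have h0 : 0 < h by rewrite divr_gt0// mulr_gt0.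
  have hE : 16 * (`|b| + 1) * h = d by rewrite mulrC divfK// gt_eqF// mulr_gt0.
  have [e1 e10 lsc] := op_face_norm_lsc HXs HA Fb bmin h0 (ltW L1).
  have [N1 HN1] := harmonic_lt e10; have [N2 HN2] := harmonic_lt h0.
  exists (maxn N1 N2) => // n /=; rewrite geq_max => /andP[Nn1 Nn2].
  have n1 := ltW (HN1 _ Nn1); have n2 := ltW (HN2 _ Nn2).
  have [t0 tn wv Dn an] := pP n.
  have [Aal _] := min_norm_selP HXs HA Dn.
  rewrite -/(t n) -/(w n) -/(al n) in t0 tn wv an Aal.
  have n3 : n.+1%:R^-1 <= 1 :> R by rewrite invf_le1// ler1n.
  have an1 : `|al n| <= `|b| + 1 by rewrite (le_trans an)// lerD2l.
  have := lsc _ _ _ t0 (le_trans tn n1) (le_trans wv n1) Aal an1.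
  rewrite (addrC (al n)) => S; rewrite leNgt; apply/negP => /ltW far.
  have b1 : `|b| <= `|b| + 1 by rewrite lerDl.
  have := Hd _ _ b1 an1 far.
  have k0 : 0 <= n.+1%:R^-1 :> R by [].
  have : `|al n| ^+ 2 <= (`|b| + n.+1%:R^-1) ^+ 2.
    by rewrite ler_sqr ?nnegrE ?addr_ge0.
  have := sqr_ge0 (`|b + al n| - 2 * `|b|).
  move: (n.+1%:R^-1) n2 n3 k0 => k kh k1 k0.
  have kk : k * k <= h by rewrite (le_trans _ kh)// ler_piMl.
  have bk : `|b| * k <= `|b| * h by rewrite ler_wpM2l.
  move: (`|al n| ^+ 2) (`|b + al n|) S => q S; rewrite !expr2; nra.
exists b, w, t; split.
- apply/cvgrPdist_le => e /harmonic_lt[N HN]; exists N => // n /HN/ltW ne.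
  by rewrite distrC (le_trans _ ne)//; case: (pP n).
- apply/cvgrPdist_le => e /harmonic_lt[N HN]; exists N => // n /HN/ltW ne.
  by have [t0 tn _ _ _] := pP n; rewrite sub0r normrN gtr0_norm// (le_trans tn).
- by move=> n; case: (pP n).
- by move=> n; case: (pP n).
- by move=> f; exact: cvg_pairr.
Qed.

(** * Weak limits and inclusion in the face *)

(** Evaluation at [z] is an element of the bidual, bounded by [|z|]. *)
Lemma weak_cvg_pointwise (u : nat -> dual X) (l : dual X) (z : X) :
  weak_cvg u l -> (u n z : R) @[n --> \oo] --> (l z : R).
Proof.
move=> ul; have [] := @dual_of_bounded _ _ (fun f : dual X => f z : R^o) `|z|.
- by [].
- by move=> f; rewrite mulrC; exact: dual_norm_pairing.
by move=> g gE; have := ul g; rewrite gE; under eq_fun do rewrite gE.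
Qed.

Lemma weak_cvg_bounded (u : nat -> dual X) (l : dual X) : weak_cvg u l ->
  exists2 M : R, 0 <= M & forall n, `|u n| <= M.
Proof.
move=> ul; pose F := [set f : X -> R^o | exists n, f = u n].
have [|| M HM] := @Banach_Steinhauss _ X R^o F _ _ 1.
- move=> _ [n ->]; split; last exact: dual_linear.
  by apply/bounded_funP/linear_bounded_continuous; exact: dual_continuous.
- move=> z; have /cvgP/cvg_seq_bounded := weak_cvg_pointwise (z := z) ul.
  move=> [M [_ /(_ (M + 1))]].
  rewrite ltrDl ltr01 => /(_ isT) HM; exists (M + 1) => _ [n ->].
  exact: HM.
exists `|M| => // n; rewrite dual_normE; apply: ge_sup.
  by exists `|u n 0|, 0 => //=; rewrite normr0.
move=> _ [z /= z1 <-]; rewrite (le_trans _ (ler_norm M))//.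
by apply: HM => //; exists n.
Qed.

Lemma weak_cvg_pair (u : nat -> dual X) (l : dual X) (w : nat -> X) (z : X) :
  weak_cvg u l -> w n @[n --> \oo] --> z ->
  (u n (w n) : R) @[n --> \oo] --> (l z : R).
Proof.
move=> ul wz; have [M M0 uM] := weak_cvg_bounded ul.
have -> : (fun n => u n (w n) : R) = (fun n => (u n z : R) + u n (w n - z)).
  by apply/funext => n; rewrite pairBr; ring.
rewrite -[X in _ --> X]addr0; apply: cvgD; first exact: weak_cvg_pointwise.
apply/norm_cvg0P.
apply: (@squeeze_cvgr _ _ _ _ (fun=> 0) (fun n => M * `|w n - z|)).
- apply: nearW => n; rewrite normr_ge0 (le_trans (dual_norm_pairing _ _))//.
  exact: ler_wpM2r.
- exact: cvg_cst.
- rewrite -[X in _ --> X](mulr0 M) -[X in _ * X](@normr0 _ X).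
  apply: cvgMr; apply: cvg_norm.
  by rewrite -(subrr z); apply: cvgB => //; exact: cvg_cst.
Qed.

(** Monotonicity is passed to the limit twice: against any graph point, which places the limit in
    [A x], and against [(x, ys)] after division by [t n], which gives maximality in direction
    [v]. *)
Lemma w_limsup_sub_op_face x v : w_limsup A x v `<=` op_face A x v.
Proof.
move=> xs [w [t [wv t0 tp Dn al]]].
pose u n := min_norm_sel A (x + t n *: w n).
have Au n : A (x + t n *: w n) (u n) by case: (min_norm_selP HXs HA (Dn n)).
have xn : x + t n *: w n @[n --> \oo] --> x.
  rewrite -[X in _ --> X]addr0 -(scale0r v); apply: cvgD; first exact: cvg_cst.
  exact: cvgZ.
apply/op_faceP; split.
  apply: (maximal_monotone_mem HA) => y ys Ay; rewrite pairBl subr_ge0.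
  apply: (@ler_lim_seq _ (fun n => ys (x + t n *: w n - y) : R)
      (fun n => u n (x + t n *: w n - y) : R)).
  - by apply: cvg_pairr; apply: cvgB => //; exact: cvg_cst.
  - by apply: weak_cvg_pair => //; apply: cvgB => //; exact: cvg_cst.
  - by move=> n; have := proj1 HA _ _ _ _ (Au n) Ay; rewrite pairBl subr_ge0.
move=> ys Ay.
apply: (@ler_lim_seq _ (fun n => ys (w n) : R) (fun n => u n (w n) : R)).
- exact: cvg_pairr.
- exact: weak_cvg_pair.
- move=> n; have := proj1 HA _ _ _ _ (Au n) Ay.
  have -> : x + t n *: w n - x = t n *: w n by rewrite addrC addKr.
  by rewrite pairZr pmulr_rge0// pairBl subr_ge0.
Qed.

End directional.

Theorem lemma3p1 (R : realType) (X : completeNormedModType R)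
  (HX : uniformly_convex X) (HXs : uniformly_convex (dual X))
  (A : X -> set (dual X)) (HA : maximal_monotone_op A)
  (x v : X) (Hx : op_dom A x) (Hv : v <> 0) (Hface : op_face A x v !=set0) :
  w_limsup A x v !=set0 /\ w_limsup A x v `<=` op_face A x v.
Proof.
by split; [exact: w_limsup_nonempty|exact: w_limsup_sub_op_face].
Qed.
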